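(* Let $q\in\mathbb{N}$, let $f=\sum_{c\in C} f_c X^c\in\mathbb{X}_q$ be a unit (i.e. $f_\theta\neq 0$), and let $n\in\mathbb{N}$. An $n$-th root of $f$ exists in $\mathbb{X}_q$ if and only if $h:=f_\theta X^\theta$, the initial block of $f$, possesses an $n$-th root in $\mathbb{X}_q$.
   Context: $\mathbb{N}$ is the set of positive integers, $\mathbb{N}_0=\mathbb{N}\cup\{0\}$, and $\mathbb{K}$ is the field $\mathbb{R}$ or $\mathbb{C}$. For $q\in\mathbb{N}$ put $C:=\mathbb{N}_0^q$ and $\theta:=(0,\ldots,0)\in C$. A formal power series of $q$ variables over $\mathbb{K}$ ($q$-fps) is a function $f:C\to\mathbb{K}$, with coefficients $f_c:=f(c)$, written $f(x)=\sum_{c\in C}f_cX^c$, where $X^c=x_1^{c_1}\cdots x_q^{c_q}$; $\mathbb{X}_q$ is the set of all $q$-fps. The product of $f,g\in\mathbb{X}_q$ is the Cauchy product $(fg)_c=\sum_{a,b\in C,\ a+b=c}f_ag_b$. A series $f$ is a unit if $f_\theta\ne 0$. The monomial $aX^c$ ($a\in\mathbb{K}$) is the $q$-fps whose $c$-th coefficient is $a$ and all of whose other coefficients are $0$. For $k\in\mathbb{N}_0$ let $C_k:=\{c\in C: c_1+\cdots+c_q=k\}$. The order of $f$ is $\mathrm{ord}(f):=\inf\{k\in\mathbb{N}_0:\ f_c\neq 0\text{ for some }c\in C_k\}$ (with $\inf\emptyset=+\infty$), and if $\mathrm{ord}(f)\in\mathbb{N}_0$, the initial block of $f$ is the $q$-fps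 $\sum_{c\in C_{\mathrm{ord}(f)}}f_cX^c$ (for a unit $f$ this is $f_\theta X^\theta$). An $n$-th root of $f\in\mathbb{X}_q$ is any $g\in\mathbb{X}_q$ with $g^n=f$, where $g^n$ is the $n$-fold Cauchy product of $g$ with itself. *)

(* Defs.v *)
From HB Require Import structures.
From mathcomp Require Import all_boot all_order all_algebra.
From mathcomp Require Import boolp reals.
From mathcomp Require Import complex mpoly.

Set Implicit Arguments.
Unset Strict Implicit.
Unset Printing Implicit Defensive.

Import GRing.Theory.
Local Open Scope ring_scope.

(* The exponent set N_0^q is the type 'X_{1..q} of multinomials:
   componentwise addition (_ + _)%MM, zero tuple 0%MM, and mdeg c = \sum_i c i. *)

Inductive scalar_kind := RealScalars | ComplexScalars.

Definition scalar_field (R : realType) (k : scalar_kind) : fieldType :=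
  match k with
  | RealScalars => R
  | ComplexScalars => R[i]
  end.

Definition fps (q : nat) (K : fieldType) := 'X_{1..q} -> K.

Section FormalPowerSeries.
Variables (q : nat) (K : fieldType).
Implicit Types (f g : fps q K) (a : K) (c : 'X_{1..q}) (k n : nat).

Definition fps_unit f : Prop := f 0%MM != 0.

Definition fps_monomial a c : fps q K := fun d => if d == c then a else 0.

(* The degree bound on the pair p only makes the index type finite: a + b = c
   forces mdeg a <= mdeg c and mdeg b <= mdeg c. *)
Definition fps_mul f g : fps q K := fun c =>
  \sum_(p : 'X_{1..q < (mdeg c).+1, (mdeg c).+1} | c == (p.1 + p.2)%MM)
     f p.1 * g p.2.

(* fps_exp g n = g * (g * ... * g), with n factors, for 0 < n. *)
Definition fps_exp g n : fps q K := iterop n fps_mul g (fps_monomial 1 0%MM).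

Definition fps_is_root n f g : Prop := fps_exp g n = f.

Definition fps_has_nonzero_block f k : bool :=
  `[< exists c, mdeg c = k /\ f c != 0 >].

(* None stands for the order +oo of the zero series. *)
Definition fps_ord f : option nat :=
  match pselect (exists k, fps_has_nonzero_block f k) with
  | left e => Some (ex_minn e)
  | right _ => None
  end.

(* Meaningful when f has finite order; it is the zero series otherwise. *)
Definition fps_initial_block f : fps q K :=
  fun c => if fps_ord f == Some (mdeg c) then f c else 0.

End FormalPowerSeries.

(* Main.v *)
Require Import Defs.
From HB Require Import structures.
From mathcomp Require Import all_boot all_order all_algebra.
From mathcomp Require Import boolp reals.
From mathcomp Require Import complex mpoly.

(** Taking constant coefficients is multiplicative, so a root of [f] yields a
    root of [f_0 X^0].  Conversely, if [a^n = f_0], then for series [g], [g']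
    with constant coefficient [a] that agree in degrees below [d > 0], the
    degree-[d] coefficients of [g^n] and [g'^n] differ by [n a^(n-1)] times
    those of [g] and [g'].  Hence the Newton iteration with frozen derivative
    [G_(k+1) = G_k + (f - G_k^n) / (n a^(n-1))], started at [a X^0], makes one
    more degree correct at each step and converges to a root of [f]. *)

Section Roots.
Set Implicit Arguments.
Unset Strict Implicit.
Import GRing.Theory.
Local Open Scope ring_scope.

Variables (q : nat) (K : fieldType).
Implicit Types (f g u v : fps q K) (a b : K) (c : 'X_{1..q}) (k n : nat).

Definition agree_below d f g := forall c, (mdeg c < d)%N -> f c = g c.

Lemma fps_mul_coef0 f g : fps_mul f g 0%MM = f 0%MM * g 0%MM.
Proof.
rewrite /fps_mul mdeg0 (big_pred1 (bm0, bm0)) // => -[x y] /=.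
by rewrite eq_sym mnmD_eq0.
Qed.

Lemma fps_exp_coef0 g n : fps_exp g n 0%MM = g 0%MM ^+ n.
Proof.
(* [iterop] gives [fps_exp g 1] as [g] itself, so the recursion unfolds by conversion only from
   exponent 1 on; exponent 0 is split off. *)
case: n => [|n]; first by rewrite /fps_exp /= /fps_monomial eqxx.
elim: n => [|n IHn] //.
by rewrite exprS -IHn -fps_mul_coef0.
Qed.

Lemma fps_mul_monomial0 a b :
  fps_mul (fps_monomial a 0%MM) (fps_monomial b 0%MM)
  = fps_monomial (a * b) (0%MM : 'X_{1..q}).
Proof.
apply/funext => c; rewrite {3}/fps_monomial; case: eqVneq => [->|c0].
  by rewrite fps_mul_coef0 /fps_monomial eqxx.
rewrite /fps_mul big1 // => -[x y] /= /eqP cE; rewrite /fps_monomial.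
have [x0|] := eqVneq; last by rewrite mul0r.
have [y0|] := eqVneq; last by rewrite mulr0.
by rewrite cE x0 y0 addm0 eqxx in c0.
Qed.

Lemma fps_exp_monomial0 a n :
  fps_exp (fps_monomial a 0%MM) n = fps_monomial (a ^+ n) (0%MM : 'X_{1..q}).
Proof.
case: n => [//|n]; elim: n => [//|n IHn].
by rewrite exprS -fps_mul_monomial0 -IHn.
Qed.

(** A term of the product in degree below [d] only involves factors of degree below [d]. *)
Lemma agree_below_mul d f g u v : agree_below d f g -> agree_below d u v ->
  agree_below d (fps_mul f u) (fps_mul g v).
Proof.
move=> fg uv c cd; apply: eq_bigr => -[x y] /= /eqP cE.
have: (mdeg x + mdeg y < d)%N by rewrite -mdegD -cE.
move=> xyd; rewrite fg ?uv //; first exact: leq_ltn_trans (leq_addl _ _) xyd.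
exact: leq_ltn_trans (leq_addr _ _) xyd.
Qed.

Lemma agree_below_exp d f g n : agree_below d f g ->
  agree_below d (fps_exp f n) (fps_exp g n).
Proof.
move=> fg; case: n => [//|n]; elim: n => [//|n IHn].
exact: agree_below_mul fg IHn.
Qed.

(** When [x + y = c] with [x] and [y] both nonzero, both degrees are below that of [c], so these
    terms cancel. Only the pairs [(0, c)] and [(c, 0)] survive. *)
Lemma fps_mulB f g u v c : c != 0%MM ->
    agree_below (mdeg c) f g -> agree_below (mdeg c) u v ->
  fps_mul f u c - fps_mul g v c
  = f 0%MM * (u c - v c) + (f c - g c) * u 0%MM.
Proof.
move=> c0 fg uv; have c_gt0 : (0 < mdeg c)%N by rewrite lt0n mdeg_eq0.
rewrite /fps_mul -sumrB.
pose cb : 'X_{1..q < (mdeg c).+1} := BMultinom (ltnSn (mdeg c)).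
rewrite (bigD1 (bm0, cb)) /= ?add0m // (bigD1 (cb, bm0)) /=; last first.
  by rewrite addm0 eqxx xpair_eqE bmeqP /= (negbTE c0).
rewrite big1 ?addr0 => [|[[x xb] [y yb]] /= /andP[/andP[/eqP cE]]].
  (* As [c] has positive degree, the constant coefficients of [g] and [v] are those of [f] and
     [u]. *)
  rewrite -(fg 0%MM) -?(uv 0%MM) ?mdeg0 //.
  by rewrite -mulrBr -mulrBl.
rewrite !xpair_eqE !bmeqP /= => nx ny.
have mE := congr1 (@mdeg q) cE; rewrite mdegD in mE.
have x0 : x != 0%MM.
  by apply: contraNneq nx => x0; rewrite x0 eqxx eq_sym; apply/eqP;
     rewrite cE x0 add0m.
have y0 : y != 0%MM.
  by apply: contraNneq ny => y0; rewrite y0 eqxx andbT eq_sym; apply/eqP;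
     rewrite cE y0 addm0.
have xc : (mdeg x < mdeg c)%N by rewrite mE -[ltnLHS]addn0 ltn_add2l lt0n mdeg_eq0.
have yc : (mdeg y < mdeg c)%N by rewrite mE -[ltnLHS]add0n ltn_add2r lt0n mdeg_eq0.
by rewrite fg // uv // subrr.
Qed.

(** By the product rule above, each of the [n.+1] factors contributes the same term. *)
Lemma fps_expB f g c n : c != 0%MM -> agree_below (mdeg c) f g ->
  fps_exp f n.+1 c - fps_exp g n.+1 c
  = n.+1%:R * f 0%MM ^+ n * (f c - g c).
Proof.
move=> c0 fg; elim: n => [|n IHn]; first by rewrite expr0 mulr1 mul1r.
have -> h : fps_exp h n.+2 = fps_mul h (fps_exp h n.+1) by [].
rewrite fps_mulB //; last exact: agree_below_exp.
rewrite IHn fps_exp_coef0 (mulrC (f c - g c)) mulrA -mulrDl.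
by rewrite -[n.+2%:R]natr1 [in RHS]mulrDl mul1r mulrCA -exprS.
Qed.

Fixpoint root_approx f n a k : fps q K :=
  if k is k'.+1 then
    let g := root_approx f n a k' in
    fun c => g c + (f c - fps_exp g n c) / (n%:R * a ^+ n.-1)
  else fps_monomial a 0%MM.

Section Convergence.
Variables (f : fps q K) (n : nat) (a : K).
Hypotheses (f0 : a ^+ n.+1 = f 0%MM) (n0 : n.+1%:R * a ^+ n != 0).
Local Notation G := (root_approx f n.+1 a).

Lemma root_approxS k c :
  G k.+1 c = G k c + (f c - fps_exp (G k) n.+1 c) / (n.+1%:R * a ^+ n).
Proof. by []. Qed.

(** The constant coefficient is carried through the induction because it fixes the derivative in
    [fps_expB]. *)
Lemma root_approx_exp k : G k 0%MM = a /\
  agree_below k.+1 (fps_exp (G k) n.+1) f.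
Proof.
elim: k => [|k [Gk0 Gkf]].
  split=> [|c]; first by rewrite /= /fps_monomial eqxx.
  rewrite ltnS leqn0 mdeg_eq0 => /eqP ->.
  by rewrite fps_exp_coef0 /= /fps_monomial eqxx.
have GS : agree_below k.+1 (G k.+1) (G k).
  by move=> c ck; rewrite root_approxS Gkf // subrr mul0r addr0.
have GS0 : G k.+1 0%MM = a by rewrite GS ?mdeg0.
split=> // c; rewrite ltnS leq_eqVlt => /orP[/eqP ck|ck].
  have c0 : c != 0%MM by rewrite -mdeg_eq0 ck.
  have := @fps_expB (G k.+1) (G k) c n c0; rewrite ck => /(_ GS).
  (* Multiplied by the derivative, the correction is exactly the defect of the previous power in
     degree [k.+1]. *)
  rewrite GS0 root_approxS (addrC (G k c)) addrK mulrC divfK // => /eqP.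
  by rewrite (inj_eq (addIr _)) => /eqP.
by rewrite (agree_below_exp _ GS) // Gkf.
Qed.

(** Every correction after stage [k] vanishes in degrees at most [k]. *)
Lemma root_approx_agree k m : agree_below k.+1 (G (m + k)) (G k).
Proof.
elim: m => [//|m IHm] c ck; rewrite addSn root_approxS IHm //.
have [_ ->] := root_approx_exp (m + k); first by rewrite subrr mul0r addr0.
by rewrite ltnS (leq_trans _ (leq_addl _ _)).
Qed.

Lemma fps_root_lift : exists g, fps_is_root n.+1 f g.
Proof.
(* Diagonal limit: a coefficient of degree [d] is final from stage [d] on. *)
exists (fun c => G (mdeg c) c); apply/funext => c.
have [_ <- //] := root_approx_exp (mdeg c).
apply: (@agree_below_exp (mdeg c).+1) => // e; rewrite ltnS => ec.
by rewrite -(subnK ec) root_approx_agree.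
Qed.

End Convergence.

Lemma fps_has_root_iff f n : fps_unit f -> (0 < n)%N -> n%:R != 0 :> K ->
  (exists g, fps_is_root n f g) <->
  (exists g, fps_is_root n (fps_monomial (f 0%MM) 0%MM) g).
Proof.
case: n => // n fu _ n0; split=> -[g gn].
  exists (fps_monomial (g 0%MM) 0%MM).
  by rewrite /fps_is_root fps_exp_monomial0 -fps_exp_coef0 gn.
have g0 : g 0%MM ^+ n.+1 = f 0%MM.
  by rewrite -fps_exp_coef0 gn /fps_monomial eqxx.
(* The derivative is nonzero: a zero root [g 0%MM] would force [f 0%MM] to vanish. *)
apply: (fps_root_lift g0); rewrite mulf_neq0 // expf_neq0 //.
by apply: contraNneq fu => g00; rewrite -g0 g00 expr0n.
Qed.

Lemma fps_ord_unit f : fps_unit f -> fps_ord f = Some 0%N.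
Proof.
move=> fu; have f0 : fps_has_nonzero_block f 0%N.
  by apply/asboolP; exists 0%MM; rewrite mdeg0.
rewrite /fps_ord; case: pselect => [e|]; last by case; exists 0%N.
by case: ex_minnP => m _ /(_ _ f0); rewrite leqn0 => /eqP ->.
Qed.

Lemma fps_initial_block_unit f : fps_unit f ->
  fps_initial_block f = fps_monomial (f 0%MM) 0%MM.
Proof.
move=> fu; apply/funext => c.
rewrite /fps_initial_block fps_ord_unit // /fps_monomial -mdeg_eq0.
have -> : (Some 0%N == Some (mdeg c)) = (mdeg c == 0%N) by rewrite eq_sym.
by case: eqP => // /eqP; rewrite mdeg_eq0 => /eqP ->.
Qed.

End Roots.

(** Both scalar fields have characteristic zero, so the derivative can be inverted. *)
Lemma scalar_field_natr_neq0 (R : realType) (k : scalar_kind) (n : nat) :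
  (0 < n)%N -> (n%:R != 0 :> scalar_field R k)%R.
Proof. by case: k => n_gt0; rewrite Num.Theory.pnatr_eq0 -lt0n. Qed.

Theorem theorem10 (R : realType) (k : scalar_kind) (q : nat) (hq : (0 < q)%N)
    (f : fps q (scalar_field R k)) (hf : fps_unit f) (n : nat) (hn : (0 < n)%N) :
  let h := fps_monomial (f 0%MM) 0%MM in
  fps_initial_block f = h /\
  ((exists g : fps q (scalar_field R k), fps_is_root n f g) <->
   (exists g : fps q (scalar_field R k), fps_is_root n h g)).
Proof.
split; first exact: fps_initial_block_unit.
by apply: fps_has_root_iff => //; exact: scalar_field_natr_neq0.
Qed.
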